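(* Consider the subgradient descent method with step-size sequence $\{\alpha_k\}$ applied to the correlation minimization problem $$\min_{r}\ f(r):=\|\mathbf{X}^Tr\|_\infty\quad\text{s.t. } r\in P_{\mathrm{res}},$$ initialized at $\hat r^0=\mathbf{y}$. Then: (i) the $\mathrm{FS}_\varepsilon$ algorithm is an instance of subgradient descent, with constant step-size $\alpha_k:=\varepsilon$ at each iteration; (ii) the $\mathrm{FS}_{\varepsilon_k}$ algorithm is an instance of subgradient descent, with non-uniform step-sizes $\alpha_k:=\varepsilon_k$ at iteration $k$; (iii) the LS-Boost$(\varepsilon)$ algorithm is an instance of subgradient descent, with non-uniform step-sizes $\alpha_k:=\varepsilon|\tilde u_{j_k}|$ at iteration $k$, where $\tilde u_{j_k}:=\arg\min_u\|\hat r^k-\mathbf{X}_{j_k}u\|_2^2$.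
   Context: Standing data: $\mathbf{X}=[\mathbf{X}_1,\ldots,\mathbf{X}_p]\in\mathbb{R}^{n\times p}$ has entries $x_{im}$ and columns with zero mean and unit $\ell_2$ norm, and $\mathbf{y}\in\mathbb{R}^n$ has zero mean. $P_{\mathrm{res}}:=\{r\in\mathbb{R}^n: r=\mathbf{y}-\mathbf{X}\beta\text{ for some }\beta\in\mathbb{R}^p\}$. $\mathrm{sgn}(a)\in\{-1,0,1\}$ is the sign of $a$, with $\mathrm{sgn}(0)=0$. Subgradient descent for minimizing a convex function $f$ over a closed convex set $P$: at iterate $x^k$, take a subgradient $g^k\in\partial f(x^k)$, i.e. a vector with $f(y)\ge f(x^k)+(g^k)^T(y-x^k)$ for all $y\in P$, and set $x^{k+1}=\Pi_P(x^k-\alpha_kg^k)$, where $\Pi_P$ is Euclidean projection onto $P$. An algorithm producing residuals $\hat r^k$ is ''an instance of subgradient descent with step-sizes $\alpha_k$'' if $\hat r^0$ is the given initial point and for each $k$ there is $g^k\in\partial f(\hat r^k)$ with $\hat r^{k+1}=\Pi_{P_{\mathrm{res}}}(\hat r^k-\alpha_kg^k)$. All three algorithms start at $\hat r^0=\mathbf{y}$, $\hat\beta^0=0$, with $\varepsilon>0$. $\mathrm{FS}_\varepsilon$: for $k=0,1,\ldots$ choose any $j_k\in\arg\max_{j}|(\hat r^k)^T\mathbf{X}_j|$, set $\hat r^{k+1}=\hat r^k-\varepsilon\,\mathrm{sgn}((\hat r^k)^T\mathbf{X}_{j_k})\mathbf{X}_{j_k}$, $\hat\beta^{k+1}_{j_k}=\hat\beta^k_{j_k}+\varepsilon\,\mathrm{sgn}((\hat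 r^k)^T\mathbf{X}_{j_k})$, $\hat\beta^{k+1}_j=\hat\beta^k_j$ for $j\neq j_k$. $\mathrm{FS}_{\varepsilon_k}$: the same as $\mathrm{FS}_\varepsilon$, with $\varepsilon$ replaced at iteration $k$ by $\varepsilon_k$, where $\{\varepsilon_k\}$ is a given sequence of (nonnegative) learning rates. LS-Boost$(\varepsilon)$: for $k=0,1,\ldots$, for each $m$ let $\tilde u_m=\arg\min_{u\in\mathbb{R}}\sum_{i=1}^n(\hat r^k_i-x_{im}u)^2$, choose any $j_k\in\arg\min_{1\le m\le p}\sum_{i=1}^n(\hat r^k_i-x_{im}\tilde u_m)^2$, set $\hat r^{k+1}=\hat r^k-\varepsilon\mathbf{X}_{j_k}\tilde u_{j_k}$, $\hat\beta^{k+1}_{j_k}=\hat\beta^k_{j_k}+\varepsilon\tilde u_{j_k}$, $\hat\beta^{k+1}_j=\hat\beta^k_j$ for $j\ne j_k$. *)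

(* Defs.v *)
From mathcomp Require Import all_boot all_order all_algebra.
From mathcomp Require Import all_classical all_reals all_analysis.

Set Implicit Arguments.
Unset Strict Implicit.
Unset Printing Implicit Defensive.

Import Order.TTheory GRing.Theory Num.Theory.

Local Open Scope classical_set_scope.
Local Open Scope ring_scope.

Definition dot (R : realType) (n : nat) (u v : 'cV[R]_n) : R := (u^T *m v) 0 0.

(* The Euclidean norm; the norm [`|u|] of MathComp-Analysis on matrices
   is the sup norm [mx_norm]. *)
Definition l2norm (R : realType) (n : nat) (u : 'cV[R]_n) : R :=
  Num.sqrt (\sum_(i < n) u i 0 ^+ 2).

Definition mean (R : realType) (n : nat) (u : 'cV[R]_n) : R :=
  (\sum_(i < n) u i 0) / n%:R.

Definition argmin (R : realType) (T : Type) (A : set T) (F : T -> R) : set T :=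
  [set x | A x /\ forall z, A z -> F x <= F z].

Definition argmax (R : realType) (T : Type) (A : set T) (F : T -> R) : set T :=
  [set x | A x /\ forall z, A z -> F z <= F x].

(* [xget 0] picks an element of the set; its default value 0 is returned only
   when the minimum over [P] is not attained. *)
Definition proj (R : realType) (n : nat) (P : set 'cV[R]_n) (x : 'cV[R]_n) :
    'cV[R]_n :=
  xget 0 (argmin P (fun z => l2norm (x - z))).

Definition subdifferential (R : realType) (n : nat) (f : 'cV[R]_n -> R)
    (P : set 'cV[R]_n) (x : 'cV[R]_n) : set 'cV[R]_n :=
  [set g | forall z, P z -> f x + dot g (z - x) <= f z].

Definition subgradient_descent (R : realType) (n : nat) (f : 'cV[R]_n -> R)
    (P : set 'cV[R]_n) (alpha : nat -> R) (x0 : 'cV[R]_n)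
    (x : nat -> 'cV[R]_n) : Prop :=
  x 0%N = x0 /\
  forall k : nat, exists2 g : 'cV[R]_n,
    subdifferential f P (x k) g & x k.+1 = proj P (x k - alpha k *: g).

Definition Pres (R : realType) (n p : nat) (X : 'M[R]_(n, p)) (y : 'cV[R]_n) :
    set 'cV[R]_n :=
  [set r | exists beta : 'cV[R]_p, r = y - X *m beta].

Definition max_corr (R : realType) (n p : nat) (X : 'M[R]_(n, p))
    (r : 'cV[R]_n) : R :=
  mx_norm (X^T *m r).

(* A run of an algorithm is recorded by its chosen indices [j], its residuals
   [r] and its coefficients [beta]; ties in the choice of [j k] are arbitrary. *)
Definition FS_run (R : realType) (n p : nat) (X : 'M[R]_(n, p)) (y : 'cV[R]_n)
    (eps : nat -> R) (j : nat -> 'I_p) (r : nat -> 'cV[R]_n)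
    (beta : nat -> 'cV[R]_p) : Prop :=
  [/\ r 0%N = y, beta 0%N = 0 &
    forall k : nat,
      let s := Num.sg (dot (r k) (col (j k) X)) in
      [/\ argmax setT (fun m : 'I_p => `|dot (r k) (col m X)|) (j k),
          r k.+1 = r k - (eps k * s) *: col (j k) X,
          beta k.+1 (j k) 0 = beta k (j k) 0 + eps k * s &
          forall l : 'I_p, l != j k -> beta k.+1 l 0 = beta k l 0]].

Definition LS_coef (R : realType) (n p : nat) (X : 'M[R]_(n, p))
    (r : 'cV[R]_n) (m : 'I_p) : R :=
  xget 0 (argmin setT (fun u : R => \sum_(i < n) (r i 0 - X i m * u) ^+ 2)).

Definition LSBoost_run (R : realType) (n p : nat) (X : 'M[R]_(n, p))
    (y : 'cV[R]_n) (eps : R) (j : nat -> 'I_p) (r : nat -> 'cV[R]_n)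
    (beta : nat -> 'cV[R]_p) : Prop :=
  [/\ r 0%N = y, beta 0%N = 0 &
    forall k : nat,
      let u := LS_coef X (r k) in
      [/\ argmin setT
            (fun m : 'I_p => \sum_(i < n) (r k i 0 - X i m * u m) ^+ 2) (j k),
          r k.+1 = r k - (eps * u (j k)) *: col (j k) X,
          beta k.+1 (j k) 0 = beta k (j k) 0 + eps * u (j k) &
          forall l : 'I_p, l != j k -> beta k.+1 l 0 = beta k l 0]].

(* Main.v *)
Require Import Defs.
From mathcomp Require Import all_boot all_order all_algebra.
From mathcomp Require Import all_classical all_reals all_analysis.
From mathcomp Require Import ring.

Set Implicit Arguments.
Unset Strict Implicit.
Unset Printing Implicit Defensive.

Import Order.TTheory GRing.Theory Num.Theory.

Local Open Scope classical_set_scope.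
Local Open Scope ring_scope.

(** Let [r] be a residual and let [m] maximize [`|dot r (col m X)|], so that
    [max_corr X r] equals this value.  Write [s] for the sign of
    [dot r (col m X)].  The linear function [z |-> dot (s *: col m X) z] lies
    below [max_corr X] everywhere and agrees with it at [r], so
    [s *: col m X] is a subgradient at [r] (lemma [sign_col_subgradient]).
    When the maximal correlation is [0] the sign is [0], and the subgradient is
    the zero vector, as it should be at a minimizer.

    Moving a residual along a column of [X] gives a residual again, so the
    projection onto [Pres X y] does nothing (lemma [proj_id]).  Hence any
    scheme that subtracts [alpha k * s] times a column of maximal correlation
    is subgradient descent with step sizes [alpha]
    (lemma [max_corr_step_subgradient_descent]).  Forward stagewise regression
    has this form literally.  For LS-Boost, completing the square along a unit
    column [x] gives
    [\sum_i (r i 0 - x i 0 * u) ^+ 2 = dot r r - dot r x ^+ 2 + (u - dot r x) ^+ 2]: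
    the best coefficient is the correlation itself, so the column of least
    residual sum of squares is a column of maximal correlation, and
    [eps * dot r x = (eps * `|dot r x|) * s]. *)

(** * Inner products *)

Lemma dotE (R : realType) (n : nat) (u v : 'cV[R]_n) :
  dot u v = \sum_(i < n) u i 0 * v i 0.
Proof. by rewrite /dot mxE; apply: eq_bigr => i _; rewrite mxE. Qed.

Lemma dotC (R : realType) (n : nat) (u v : 'cV[R]_n) : dot u v = dot v u.
Proof. by rewrite !dotE; apply: eq_bigr => i _; rewrite mulrC. Qed.

Lemma dotBr (R : realType) (n : nat) (u v w : 'cV[R]_n) :
  dot u (v - w) = dot u v - dot u w.
Proof. by rewrite /dot mulmxBr !mxE. Qed.

Lemma dotZl (R : realType) (n : nat) (a : R) (u v : 'cV[R]_n) :
  dot (a *: u) v = a * dot u v.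
Proof. by rewrite /dot linearZ /= -scalemxAl !mxE. Qed.

Lemma l2norm_sqr (R : realType) (n : nat) (u : 'cV[R]_n) :
  l2norm u ^+ 2 = dot u u.
Proof.
rewrite /l2norm sqr_sqrtr; last by apply: sumr_ge0 => i _; apply: sqr_ge0.
by rewrite dotE; apply: eq_bigr => i _; rewrite expr2.
Qed.

Lemma l2norm0 (R : realType) (n : nat) : l2norm (0 : 'cV[R]_n) = 0.
Proof. by rewrite /l2norm big1 ?sqrtr0// => i _; rewrite mxE expr0n. Qed.

Lemma l2norm_eq0 (R : realType) (n : nat) (u : 'cV[R]_n) :
  l2norm u = 0 -> u = 0.
Proof.
move=> u0; have /eqP : \sum_(i < n) u i 0 ^+ 2 = 0.
  have := l2norm_sqr u; rewrite u0 expr0n dotE /= => dot0.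
  by rewrite [RHS]dot0; apply: eq_bigr => i _; rewrite expr2.
rewrite psumr_eq0 => [/allP h|i _]; last exact: sqr_ge0.
apply/colP => i; rewrite mxE; apply/eqP; rewrite -(sqrf_eq0 (u i 0)).
by apply: (implyP (h i _)); rewrite ?mem_index_enum.
Qed.

(** * Projection onto the residuals *)

Lemma proj_id (R : realType) (n : nat) (P : set 'cV[R]_n) (x : 'cV[R]_n) :
  P x -> Defs.proj P x = x.
Proof.
move=> Px; apply: xget_unique.
  by split=> // z _; rewrite subrr l2norm0 sqrtr_ge0.
move=> z [_ /(_ x Px)]; rewrite subrr l2norm0 => xz.
by apply/esym/subr0_eq/l2norm_eq0/eqP; rewrite eq_le xz sqrtr_ge0.
Qed.

(** The step [a *: col m X] is the image under [X] of [a] at coordinate [m]. *)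
Lemma Pres_sub_col (R : realType) (n p : nat) (X : 'M[R]_(n, p))
    (y r : 'cV[R]_n) (a : R) (m : 'I_p) :
  Pres X y r -> Pres X y (r - a *: col m X).
Proof.
move=> [beta ->]; exists (beta + a *: delta_mx m 0).
by rewrite mulmxDr -scalemxAr -colE opprD addrA.
Qed.

(** * Subgradients of the maximal correlation *)

Lemma tr_mul_dot (R : realType) (n p : nat) (X : 'M[R]_(n, p))
    (r : 'cV[R]_n) (m : 'I_p) : (X^T *m r) m 0 = dot r (col m X).
Proof.
by rewrite dotC dotE mxE; apply: eq_bigr => i _; rewrite !mxE.
Qed.

Lemma dot_le_max_corr (R : realType) (n p : nat) (X : 'M[R]_(n, p))
    (r : 'cV[R]_n) (m : 'I_p) : `|dot r (col m X)| <= max_corr X r.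
Proof.
rewrite /max_corr mx_normrE -tr_mul_dot.
exact: (le_bigmax _ (fun ij : 'I_p * 'I_1 => `|(X^T *m r) ij.1 ij.2|) (m, 0)).
Qed.

Lemma max_corr_argmax (R : realType) (n p : nat) (X : 'M[R]_(n, p))
    (r : 'cV[R]_n) (m : 'I_p) :
  argmax setT (fun l : 'I_p => `|dot r (col l X)|) m ->
  max_corr X r = `|dot r (col m X)|.
Proof.
move=> [_ mmax]; apply/eqP; rewrite eq_le dot_le_max_corr andbT.
rewrite /max_corr mx_normrE; apply: bigmax_le => // -[l k] _ /=.
by rewrite (ord1 k) tr_mul_dot mmax.
Qed.

(** The inequality is [s * dot z x <= `|dot z x| <= max_corr X z], with
    equality at [z = r] because [s * dot r x = `|dot r x|]; this includes the
    degenerate case [s = 0]. *)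
Lemma sign_col_subgradient (R : realType) (n p : nat) (X : 'M[R]_(n, p))
    (P : set 'cV[R]_n) (r : 'cV[R]_n) (m : 'I_p) :
  argmax setT (fun l : 'I_p => `|dot r (col l X)|) m ->
  subdifferential (max_corr X) P r
    (Num.sg (dot r (col m X)) *: col m X).
Proof.
move=> mmax z _; rewrite (max_corr_argmax mmax) dotBr !dotZl.
rewrite ![dot (col m X) _]dotC -normrEsg addrC subrK.
apply: le_trans (dot_le_max_corr X z m).
apply: le_trans (ler_norm _) _.
by rewrite normrM normr_sg ler_piMl// lern1 leq_b1.
Qed.

Lemma max_corr_step_subgradient_descent (R : realType) (n p : nat)
    (X : 'M[R]_(n, p)) (y : 'cV[R]_n) (alpha : nat -> R) (j : nat -> 'I_p)
    (r : nat -> 'cV[R]_n) :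
  r 0%N = y ->
  (forall k, argmax setT (fun m : 'I_p => `|dot (r k) (col m X)|) (j k)) ->
  (forall k, r k.+1 =
     r k - (alpha k * Num.sg (dot (r k) (col (j k) X))) *: col (j k) X) ->
  subgradient_descent (max_corr X) (Pres X y) alpha y r.
Proof.
move=> r0 jmax rS; split=> // k.
(* The iterates never leave [Pres X y], where the projection is the identity. *)
have resid i : Pres X y (r i).
  elim: i => [|i IHi]; last by rewrite rS; apply: Pres_sub_col.
  by rewrite r0; exists 0; rewrite mulmx0 subr0.
exists (Num.sg (dot (r k) (col (j k) X)) *: col (j k) X).
  exact: sign_col_subgradient.
by rewrite scalerA -rS proj_id.
Qed.

Lemma FS_run_subgradient_descent (R : realType) (n p : nat)
    (X : 'M[R]_(n, p)) (y : 'cV[R]_n) (eps : nat -> R) (j : nat -> 'I_p)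
    (r : nat -> 'cV[R]_n) (beta : nat -> 'cV[R]_p) :
  FS_run X y eps j r beta ->
  subgradient_descent (max_corr X) (Pres X y) eps y r.
Proof.
move=> [r0 _ step]; apply: (max_corr_step_subgradient_descent r0 (j := j)) => k.
  by have [] := step k.
by have [] := step k.
Qed.

(** * Least squares along a unit column *)

(** Completing the square, with [dot x x = 1] for the column [x]. *)
Lemma sum_sqr_sub (R : realType) (n p : nat) (X : 'M[R]_(n, p))
    (r : 'cV[R]_n) (m : 'I_p) (u : R) :
  l2norm (col m X) = 1 ->
  \sum_(i < n) (r i 0 - X i m * u) ^+ 2 =
  dot r r - dot r (col m X) ^+ 2 + (u - dot r (col m X)) ^+ 2.
Proof.
move=> unitX; transitivity
    (dot r r - 2 * u * dot r (col m X) + u ^+ 2 * dot (col m X) (col m X)).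
  rewrite !dotE !mulr_sumr -sumrB -big_split /=; apply: eq_bigr => i _.
  by rewrite !mxE; ring.
by rewrite -(l2norm_sqr (col m X)) unitX; ring.
Qed.

(** The vertex [d] of the parabola is its only minimizer, so the choice made by
    [xget] is forced. *)
Lemma xget_argmin_sqr (R : realType) (F : R -> R) (c d : R) :
  (forall u, F u = c + (u - d) ^+ 2) -> xget 0 (argmin setT F) = d.
Proof.
move=> FE; have Fd : F d = c by rewrite FE subrr expr0n addr0.
apply: xget_unique => [|u [_ /(_ d I)]].
  by split=> // u _; rewrite Fd FE lerDl sqr_ge0.
rewrite Fd FE gerDl => ud; apply/eqP; rewrite -subr_eq0 -sqrf_eq0.
by rewrite eq_le ud sqr_ge0.
Qed.

Lemma LS_coefE (R : realType) (n p : nat) (X : 'M[R]_(n, p))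
    (r : 'cV[R]_n) (m : 'I_p) :
  l2norm (col m X) = 1 -> LS_coef X r m = dot r (col m X).
Proof.
by move=> unitX; apply: xget_argmin_sqr => u; apply: sum_sqr_sub.
Qed.

Lemma xget_argmin_l2norm (R : realType) (n p : nat) (X : 'M[R]_(n, p))
    (r : 'cV[R]_n) (m : 'I_p) :
  l2norm (col m X) = 1 ->
  xget 0 (argmin setT (fun u : R => l2norm (r - u *: col m X) ^+ 2)) =
  dot r (col m X).
Proof.
move=> unitX; apply: xget_argmin_sqr => u.
apply: etrans (sum_sqr_sub r u unitX); rewrite l2norm_sqr dotE.
by apply: eq_bigr => i _; rewrite !mxE expr2 [u * _]mulrC.
Qed.

(** The minimal residual sum of squares along [col m X] is
    [dot r r - dot r (col m X) ^+ 2], so minimizing it over [m] maximizes the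
    absolute correlation. *)
Lemma LS_argmin_argmax (R : realType) (n p : nat) (X : 'M[R]_(n, p))
    (r : 'cV[R]_n) (m : 'I_p) :
  (forall l : 'I_p, l2norm (col l X) = 1) ->
  argmin setT
    (fun l : 'I_p => \sum_(i < n) (r i 0 - X i l * LS_coef X r l) ^+ 2) m ->
  argmax setT (fun l : 'I_p => `|dot r (col l X)|) m.
Proof.
move=> unitX [_ mmin]; split=> // l _; have := mmin l I.
rewrite !sum_sqr_sub// !LS_coefE// !subrr expr0n !addr0 lerD2l lerN2.
by rewrite -ler_sqrt ?sqr_ge0// !sqrtr_sqr.
Qed.

Lemma LSBoost_run_subgradient_descent (R : realType) (n p : nat)
    (X : 'M[R]_(n, p)) (y : 'cV[R]_n) (eps : R) (j : nat -> 'I_p)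
    (r : nat -> 'cV[R]_n) (beta : nat -> 'cV[R]_p) :
  (forall m : 'I_p, l2norm (col m X) = 1) ->
  LSBoost_run X y eps j r beta ->
  subgradient_descent (max_corr X) (Pres X y)
    (fun k => eps * `|xget 0 (argmin setT
       (fun u : R => l2norm (r k - u *: col (j k) X) ^+ 2))|) y r.
Proof.
move=> unitX [r0 _ step].
apply: (max_corr_step_subgradient_descent r0 (j := j)) => k.
  by have [jmin _ _ _] := step k; apply: LS_argmin_argmax.
have [_ -> _ _] := step k; rewrite LS_coefE// xget_argmin_l2norm//.
by rewrite -mulrA [`|_| * _]mulrC -numEsg.
Qed.

Theorem proposition3p2 (R : realType) (n p : nat)
    (X : 'M[R]_(n, p)) (y : 'cV[R]_n)
    (X_centered : forall m : 'I_p, mean (col m X) = 0)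
    (X_unit : forall m : 'I_p, l2norm (col m X) = 1)
    (y_centered : mean y = 0) :
  [/\ (forall (eps : R) (j : nat -> 'I_p) (r : nat -> 'cV[R]_n)
          (beta : nat -> 'cV[R]_p),
        0 < eps ->
        FS_run X y (fun=> eps) j r beta ->
        subgradient_descent (max_corr X) (Pres X y) (fun=> eps) y r),
      (forall (eps : nat -> R) (j : nat -> 'I_p) (r : nat -> 'cV[R]_n)
          (beta : nat -> 'cV[R]_p),
        (forall k : nat, 0 <= eps k) ->
        FS_run X y eps j r beta ->
        subgradient_descent (max_corr X) (Pres X y) eps y r) &
      (forall (eps : R) (j : nat -> 'I_p) (r : nat -> 'cV[R]_n)
          (beta : nat -> 'cV[R]_p),
        0 < eps ->
        LSBoost_run X y eps j r beta ->
        subgradient_descent (max_corr X) (Pres X y)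
          (fun k => eps * `|xget 0 (argmin setT
             (fun u : R => l2norm (r k - u *: col (j k) X) ^+ 2))|) y r)].
Proof.
split=> [eps j r beta _|eps j r beta _|eps j r beta _].
- exact: FS_run_subgradient_descent.
- exact: FS_run_subgradient_descent.
- exact: LSBoost_run_subgradient_descent.
Qed.
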